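(* Let $d\ge 1$, $n\ge 1$ and $t\ge 1$ be integers. If the directed de Bruijn graph $\vec{\mathcal B}(d,n)$ has a $t$-identifying code, then every $t$-identifying code $S$ of $\vec{\mathcal B}(d,n)$ satisfies $|S|\ge d^{n-1}(d-1)$.
   Context: Let $\mathcal A_d=\{0,1,\dots,d-1\}$ and let $\mathcal A_d^n$ be the set of strings $x=x_1x_2\cdots x_n$ of length $n$ over $\mathcal A_d$. The directed de Bruijn graph $\vec{\mathcal B}(d,n)$ has vertex set $\mathcal A_d^n$ and an arc from $x_1x_2\cdots x_n$ to $y_1y_2\cdots y_n$ if and only if $x_2\cdots x_n=y_1\cdots y_{n-1}$ (in particular constant strings carry loops). $\vec d(u,v)$ denotes the length of a shortest directed walk from $u$ to $v$. The in-ball of radius $t$ is $B_t^-(v)=\{u:\vec d(u,v)\le t\}$ (it contains $v$). For $S\subseteq V$, let $\mathrm{ID}_S(v)=B_t^-(v)\cap S$. A $t$-identifying code is a set $S\subseteq V$ such that $\mathrm{ID}_S(v)\neq\emptyset$ for every vertex $v$ and $\mathrm{ID}_S(u)\ne\mathrm{ID}_S(v)$ for all distinct vertices $u,v$. *)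

(* Defs.v *)
From HB Require Import structures.
From mathcomp Require Import all_boot.
Set Implicit Arguments.
Unset Strict Implicit.
Unset Printing Implicit Defensive.

Section Digraph.

Variables (T : finType) (e : rel T).

(* A walk of length k from u is given by the k vertices that follow u. *)
Definition has_walk (u v : T) (k : nat) : bool :=
  [exists p : k.-tuple T, path e u p && (last u p == v)].

Lemma connect_walk (u v : T) : connect e u v -> exists k, has_walk u v k.
Proof.
case/connectP=> p pathp ->; exists (size p).
by apply/existsP; exists (in_tuple p); rewrite pathp eqxx.
Qed.

(* None stands for an infinite distance. *)
Definition ddist (u v : T) : option nat :=
  if @idP (connect e u v) is ReflectT c
  then Some (ex_minn (connect_walk c)) else None.

Definition in_ball (t : nat) (v : T) : {set T} :=
  [set u | if ddist u v is Some k then k <= t else false].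

Definition ID_set (t : nat) (S : {set T}) (v : T) : {set T} :=
  in_ball t v :&: S.

Definition identifying_code (t : nat) (S : {set T}) : Prop :=
  (forall v, ID_set t S v <> set0) /\
  (forall u v, u <> v -> ID_set t S u <> ID_set t S v).

Lemma ddistP (u v : T) (k : nat) :
  ddist u v = Some k <->
  has_walk u v k /\ (forall j, has_walk u v j -> k <= j).
Proof.
rewrite /ddist; case: {-}_ / idP => [c|nc].
  case: ex_minnP => m wm minm; split=> [[<-]//|[wk mink]].
  by congr Some; apply/eqP; rewrite eqn_leq minm ?mink.
split=> // -[/existsP[p /andP[pathp /eqP lastp]] _].
by case: nc; apply/connectP; exists p.
Qed.

Lemma in_ballP (t : nat) (u v : T) :
  reflect (exists2 k, k <= t & has_walk u v k) (u \in in_ball t v).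
Proof.
rewrite inE; apply: (iffP idP) => [|[k lekt wk]].
  case E: (ddist u v) => [k|//] lekt; exists k => //.
  by case/ddistP: E.
case E: (ddist u v) => [m|].
  by case/ddistP: E => _ /(_ k wk) /leq_trans; apply.
move: E; rewrite /ddist; case: {-}_ / idP => // nc _; case: nc.
by case/existsP: wk => p /andP[pathp /eqP lastp]; apply/connectP; exists p.
Qed.

End Digraph.

(* x_2 ... x_n = y_1 ... y_(n-1) *)
Definition debruijn (d n : nat) : rel (n.-tuple 'I_d) :=
  fun x y => behead x == take n.-1 y.
Arguments debruijn : clear implicits.

(* Main.v *)
Require Import Defs.
From mathcomp Require Import all_boot.

Set Implicit Arguments.
Unset Strict Implicit.
Unset Printing Implicit Defensive.

(** Call two vertices in-twins if they have the same in-neighbours. A nonempty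
    walk ending at a vertex can be redirected to any in-twin by changing its
    last step, so the in-balls of in-twins differ at most in the two vertices
    themselves, and a code that separates them contains one of them. In the
    de Bruijn graph, words with the same prefix of length [n - 1] are in-twins;
    hence a code misses at most one word for each of the [d ^ (n - 1)]
    prefixes. *)

Section InTwins.

Variables (T : finType) (e : rel T).

Definition in_twins (x y : T) : Prop := e^~ x =1 e^~ y.

Lemma has_walk0 (u v : T) : has_walk e u v 0 = (u == v).
Proof.
apply/existsP/eqP => [[p /andP[_ /eqP]]|->]; first by rewrite (tuple0 p).
by exists [tuple]; rewrite /= eqxx.
Qed.

Lemma has_walkSr (u v : T) (k : nat) :
  has_walk e u v k.+1 = [exists w, has_walk e u w k && e w v].
Proof.
apply/existsP/existsP => [[[p sz_p]]|[w /andP[/existsP[p]]]].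
- case/lastP: p sz_p => [//|p z] /=; rewrite size_rcons eqSS => sz_p.
  rewrite rcons_path last_rcons => /andP[/andP[walk_p step] /eqP <-].
  exists (last u p); rewrite step andbT; apply/existsP.
  by exists (Tuple sz_p); rewrite walk_p eqxx.
- move=> /andP[walk_p /eqP <-] step; exists [tuple of rcons p v].
  by rewrite /= rcons_path last_rcons walk_p step eqxx.
Qed.

Lemma has_walkS_twins (u x y : T) (k : nat) :
  in_twins x y -> has_walk e u x k.+1 = has_walk e u y k.+1.
Proof.
by move=> twins; rewrite !has_walkSr; apply: eq_existsb => w; rewrite twins.
Qed.

Lemma in_ball_twins_subset (t : nat) (x y : T) :
  in_twins x y -> in_ball e t x \subset x |: in_ball e t y.
Proof.
move=> twins; apply/subsetP => u /in_ballP[[|k] le_kt walk]; apply/setU1P.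
- by left; apply/eqP; rewrite -has_walk0.
- right; apply/in_ballP; exists k.+1 => //.
  by rewrite -(has_walkS_twins _ _ twins).
Qed.

Lemma ID_set_twins_subset (t : nat) (S : {set T}) (x y : T) :
  in_twins x y -> x \notin S -> ID_set e t S x \subset ID_set e t S y.
Proof.
move=> /(in_ball_twins_subset t)/subsetP sub_ball xNS.
apply/subsetP => u /setIP[/sub_ball/setU1P[->|u_ball] uS].
  by rewrite uS in xNS.
by apply/setIP.
Qed.

Lemma identifying_code_twins_eq (t : nat) (S : {set T}) (x y : T) :
  identifying_code e t S -> in_twins x y ->
  x \notin S -> y \notin S -> x = y.
Proof.
move=> [_ separates] twins xNS yNS; apply/eqP.
apply: contraT => /eqP/separates[].
apply/eqP; rewrite eqEsubset.
by rewrite !ID_set_twins_subset //; apply: fsym.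
Qed.

Lemma leq_card_setC_identifying_code (U : finType) (f : T -> U)
    (t : nat) (S : {set T}) :
  (forall x y, f x = f y -> in_twins x y) ->
  identifying_code e t S -> #|~: S| <= #|U|.
Proof.
move=> twins_of_eq codeS; apply: (@leq_card_in _ _ f) => x y.
rewrite !inE => xNS yNS /twins_of_eq twins.
exact: identifying_code_twins_eq codeS twins xNS yNS.
Qed.

End InTwins.

Lemma debruijn_in_twins (d n : nat) (x y : n.-tuple 'I_d) :
  take n.-1 x = take n.-1 y -> in_twins (debruijn d n) x y.
Proof. by move=> eq_prefix v; rewrite /debruijn eq_prefix. Qed.

Lemma leq_card_setC_debruijn_code (d n t : nat) (S : {set n.-tuple 'I_d}) :
  identifying_code (debruijn d n) t S -> #|~: S| <= d ^ n.-1.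
Proof.
pose prefix (x : n.-tuple 'I_d) := [tuple of take n.-1 x].
have <- : #|{: (minn n.-1 n).-tuple 'I_d}| = d ^ n.-1.
  by rewrite card_tuple card_ord (minn_idPl (leq_pred n)).
apply: (leq_card_setC_identifying_code (f := prefix)) => x y /(congr1 val).
exact: debruijn_in_twins.
Qed.

Theorem theorem3p8 (d n t : nat) (hd : 1 <= d) (hn : 1 <= n) (ht : 1 <= t) :
  (exists S : {set n.-tuple 'I_d}, identifying_code (debruijn d n) t S) ->
  forall S : {set n.-tuple 'I_d},
    identifying_code (debruijn d n) t S -> d ^ (n - 1) * (d - 1) <= #|S|.
Proof.
move=> _ S /leq_card_setC_debruijn_code le_missed.
have card_words : #|S| + #|~: S| = d ^ n by rewrite cardsC card_tuple card_ord.
rewrite mulnBr muln1 -expnSr subn1 prednK // leq_subLR -card_words addnC.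
by rewrite leq_add2r.
Qed.
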